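(* Let $m$ and $n$ be nonnegative integers. Then $$\sum_{k=1}^n\frac{2^{2k-1}\,C_{n-k}\,H_{k-1}}{k\prod_{j=1}^m\bigl(2(n-k-j)+1\bigr)} = \frac{(-1)^m2^{2n+m}}{(2m+1)(m+1)!\,(n+1)}\,\frac{H_n}{C_m}+\frac{(O_{m-n}-O_{m+1})^2+O^{(2)}_{m-n}-O^{(2)}_{m+1}}{\prod_{j=1}^m\bigl(2(n-j)+1\bigr)}\,C_n.$$
   Context: $C_n=\frac{1}{n+1}\binom{2n}{n}$, $n\ge 0$, are the Catalan numbers. $H_n=\sum_{k=1}^n\frac1k$ with $H_0=0$. For nonnegative integers $n$, $O_n=\sum_{k=1}^n\frac{1}{2k-1}$ and $O^{(2)}_n=\sum_{k=1}^n\frac{1}{(2k-1)^2}$, with $O_0=O_0^{(2)}=0$; for negative indices, $O_{-n}=O_n$ and $O^{(2)}_{-n}=-O^{(2)}_n$. Empty sums equal $0$ and empty products equal $1$. *)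

(* Defs.v *)
From mathcomp Require Export all_boot all_order all_algebra.
Set Implicit Arguments.
Unset Strict Implicit.
Unset Printing Implicit Defensive.
Import Order.TTheory GRing.Theory Num.Theory.
Local Open Scope ring_scope.

(* Every quantity involved is rational, so the identity is stated in rat. *)

Definition catalan (n : nat) : rat := n.+1%:R^-1 * 'C(2 * n, n)%:R.

Definition harm (n : nat) : rat := \sum_(1 <= k < n.+1) k%:R^-1.

Definition oharm_nat (n : nat) : rat :=
  \sum_(1 <= k < n.+1) (2 * k%:R - 1)^-1.

Definition oharm2_nat (n : nat) : rat :=
  \sum_(1 <= k < n.+1) ((2 * k%:R - 1) ^+ 2)^-1.

(* Extensions to integer indices: O is even and O^(2) is odd.
   Recall that Negz n stands for - n.+1. *)
Definition oharm (z : int) : rat :=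
  match z with
  | Posz n => oharm_nat n
  | Negz n => oharm_nat n.+1
  end.

Definition oharm2 (z : int) : rat :=
  match z with
  | Posz n => oharm2_nat n
  | Negz n => - oharm2_nat n.+1
  end.

(* The factors of the product may be negative, so a is an integer;
   being odd, they never vanish. *)
Definition oddprod (m : nat) (a : int) : rat :=
  \prod_(1 <= j < m.+1) (2 * (a - j%:Z) + 1)%:~R.

(* Main.v *)
(** With [P_n(a)] the coefficient of [x^n] in [(1-x)^a], one has
    [C_N / prod_{j<=m} (2(N-j)+1) = K 4^(N+1) P_(N+1)(m+1/2)] with [K]
    independent of [N], while [H_(k-1)/k] is the coefficient of [x^k] in
    [L^2/2], where [L = log(1-x)].  Up to the missing term [k = n+1], which
    accounts for the summand with [H_n], the left-hand side is thus a
    coefficient of [(1-x)^a L^2/2].  The functions [f = (1-x)^a], [g = f L]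
    and [h = f L^2/2] satisfy [(1-x)f' = -af], [(1-x)g' = -ag - f] and
    [(1-x)h' = -ah - g]; the resulting first-order recurrences show that the
    coefficients of [g] and [h] are [P_n(a)] times the first and second
    elementary symmetric functions of the [1/(a-i)], [i < n]. *)
Require Import Defs.
From mathcomp Require Import all_boot all_order all_algebra.
From mathcomp Require Import ring lra zify.
Import Order.TTheory GRing.Theory Num.Theory.
Local Open Scope ring_scope.

Section BinomialSeries.

Variables (F : numFieldType) (a : F).

(** The number [P_n(a)], that is [(-1)^n] times the binomial coefficient [a] over [n]. *)
Definition bincoef (n : nat) : F := \prod_(i < n) ((i%:R - a) / i.+1%:R).

Lemma bincoefS n : n.+1%:R * bincoef n.+1 = (n%:R - a) * bincoef n.
Proof.
by rewrite /bincoef big_ord_recr /= mulrCA [X in _ * X]mulrC divfK ?pnatr_eq0 // mulrC.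
Qed.

Definition binconv (h : nat -> F) (n : nat) : F :=
  \sum_(k < n.+1) bincoef (n - k) * h k.

(** Coefficient form of [(1-x) u' = -a u + f (1-x) h'] for [u = f h]. *)
Lemma binconvS h n :
  n.+1%:R * binconv h n.+1 = (n%:R - a) * binconv h n
    + binconv (fun k => k.+1%:R * h k.+1 - k%:R * h k) n.
Proof.
(* Leibniz rule: the weight [n+1] splits as [(n+1-k) + k]. *)
have split_index : n.+1%:R * binconv h n.+1 =
    \sum_(k < n.+2) (n.+1 - k)%:R * bincoef (n.+1 - k) * h k
    + \sum_(k < n.+2) bincoef (n.+1 - k) * (k%:R * h k).
  rewrite /binconv mulr_sumr -big_split; apply: eq_bigr => k _ /=.
  rewrite natrB; last by rewrite -ltnS.
  by ring.
rewrite split_index big_ord_recr /= subnn !mul0r addr0.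
rewrite [X in _ + X]big_ord_recl /= mul0r mulr0 add0r.
rewrite /binconv mulr_sumr -!big_split; apply: eq_bigr => k _ /=.
have kn : (k <= n)%N by rewrite -ltnS.
rewrite /bump /= add1n subSS subSn // bincoefS natrB //.
by ring.
Qed.

Hypothesis a_notnat : forall i : nat, a - i%:R != 0.

(** Here [h = -L], so [(1-x) h' = 1] and the correction in [binconvS] is [bincoef n]. *)
Lemma binconv_inv n :
  binconv (fun k => k%:R^-1) n = - bincoef n * \sum_(i < n) (a - i%:R)^-1.
Proof.
elim: n => [|n IHn].
  by rewrite /binconv big_ord1 big_ord0 invr0 !mulr0.
have n1 : n.+1%:R != 0 :> F by rewrite pnatr_eq0.
apply: (mulfI n1); rewrite binconvS IHn [RHS]mulrA [in RHS]mulrN bincoefS big_ord_recr /=.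
(* As [0^-1 = 0], the difference [(k+1)/(k+1) - k/k] is [1] at [k = 0] and [0] afterwards. *)
rewrite [X in _ + X](_ : _ = bincoef n); last first.
  rewrite /binconv big_ord_recl /= subn0 mul0r subr0 divff ?oner_eq0 // mulr1.
  rewrite big1 ?addr0 // => k _.
  by rewrite !divff ?subrr ?mulr0 // pnatr_eq0.
by field; exact: a_notnat.
Qed.

(** Here [h = L^2/2] and [(1-x) h' = -L], so the correction is the previous convolution. The second
    elementary symmetric function appears as half of [p_1^2 - p_2], with [p_i] the power sums. *)
Lemma binconv_harm n :
  binconv (fun k => (\sum_(1 <= i < k) i%:R^-1) / k%:R) n =
  bincoef n * ((\sum_(i < n) (a - i%:R)^-1) ^+ 2
               - \sum_(i < n) ((a - i%:R) ^+ 2)^-1) / 2.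
Proof.
elim: n => [|n IHn].
  by rewrite /binconv big_ord1 !big_ord0 invr0 expr0n subrr !mulr0 mul0r.
have n1 : n.+1%:R != 0 :> F by rewrite pnatr_eq0.
apply: (mulfI n1); rewrite binconvS IHn ![in RHS]mulrA bincoefS !big_ord_recr /=.
rewrite [X in _ + X](_ : _ = binconv (fun k => k%:R^-1) n); last first.
  apply: eq_bigr => -[[|k] /= _] _.
    by rewrite !big_geq // invr0 !mul0r !mulr0 subrr mulr0.
  rewrite (mulrC k.+2%:R) (mulrC k.+1%:R) !divfK ?pnatr_eq0 //.
  by rewrite big_nat_recr //= addrAC subrr add0r.
rewrite binconv_inv.
by field; exact: a_notnat.
Qed.

End BinomialSeries.

Arguments bincoef {F}.
Arguments binconv {F}.

Lemma catalanS n : n.+2%:R * catalan n.+1 = 2 * (2 * n%:R + 1) * catalan n.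
Proof.
have binE k : catalan k = (2 * k)`!%:R / (k`!%:R ^+ 2 * k.+1%:R).
  rewrite /catalan -(@bin_fact (2 * k) k) ?leq_pmull //.
  rewrite (_ : (2 * k - k = k)%N); last by lia.
  rewrite !natrM.
  have k0 : k`!%:R != 0 :> rat by rewrite pnatr_eq0 -lt0n fact_gt0.
  by field; rewrite k0 /= lt0r_neq0 // ltr_wpDr.
rewrite !binE (_ : (2 * n.+1 = (2 * n).+2)%N); last by lia.
rewrite !factS !natrM -!natr1 natrM.
have k0 : n`!%:R != 0 :> rat by rewrite pnatr_eq0 -lt0n fact_gt0.
have n0 : 0 <= n%:R :> rat by rewrite ler0n.
by field; rewrite k0 /=; apply/andP; split; apply: lt0r_neq0; lra.
Qed.

Lemma odd_neq0 (z : int) : (2 * z + 1)%:~R != 0 :> rat.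
Proof. by rewrite intr_eq0; lia. Qed.

Lemma oddprod_neq0 m z : oddprod m z != 0.
Proof. by rewrite prodf_seq_neq0; apply/allP => j _; exact: odd_neq0. Qed.

(** The two products differ only in their extreme factors, [2z+1] and [2(z-m)+1]. *)
Lemma oddprod_shift m (z : int) :
  oddprod m (z + 1) * (2 * (z - m%:Z) + 1)%:~R = oddprod m z * (2 * z + 1)%:~R.
Proof.
elim: m => [|m IHm]; first by rewrite /oddprod !big_geq // !mul1r subr0.
have recr y : oddprod m.+1 y = oddprod m y * (2 * (y - m.+1%:Z) + 1)%:~R.
  by rewrite /oddprod big_nat_recr.
rewrite !recr (_ : z + 1 - m.+1%:Z = z - m%:Z); last by lia.
by rewrite IHm mulrAC.
Qed.

(** Both sides equal [2^m (2m-1)!! = (2m)!/m!]. *)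
Lemma oddprod0_catalan m :
  (-1) ^+ m * 2 ^+ m * oddprod m 0 = (m.+1)`!%:R * catalan m.
Proof.
elim: m => [|m IHm]; first by rewrite /oddprod big_geq // /catalan !mul1r.
rewrite factS natrM [RHS]mulrAC catalanS.
rewrite /oddprod big_nat_recr //= -/(oddprod m 0) !exprS.
rewrite (_ : (2 * (0 - m.+1%:Z) + 1)%:~R = - (2 * m%:R + 1) :> rat); last first.
  by rewrite (_ : 2 * (0 - m.+1%:Z) + 1 = - (2 * m%:Z + 1)); [rewrite rmorphN rmorphD rmorphM|lia].
transitivity (2 * (2 * m%:R + 1) * ((-1) ^+ m * 2 ^+ m * oddprod m 0)); first by ring.
by rewrite IHm; ring.
Qed.

(** The even extension carries the recurrence across zero: for [z <= 0] the new term [1/(1-2z)] is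
    [-1/(2z-1)]. *)
Lemma oharm_sub1 (z : int) : oharm (z - 1) = oharm z - ((2 * z - 1)%:~R)^-1.
Proof.
have castE k : (2 * k.+1%:R - 1 : rat) = (2 * k.+1%:Z - 1)%:~R by rewrite rmorphB rmorphM.
case: z => [[|k]|k].
- by rewrite /= /oharm_nat big_nat1 big_geq // add0r !mulr1.
- rewrite (_ : k.+1%:Z - 1 = k); last by lia.
  by rewrite /= /oharm_nat [in RHS]big_nat_recr //= castE addrK.
- rewrite (_ : Negz k - 1 = Negz k.+1); last by lia.
  rewrite /= /oharm_nat [in LHS]big_nat_recr //= castE -invrN -rmorphN.
  by congr (_ + (_%:~R)^-1); lia.
Qed.

(** Squaring loses the sign of [2z-1], so here the odd extension is the right one. *)
Lemma oharm2_sub1 (z : int) :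
  oharm2 (z - 1) = oharm2 z - ((2 * z - 1)%:~R ^+ 2)^-1.
Proof.
have castE k : (2 * k.+1%:R - 1 : rat) = (2 * k.+1%:Z - 1)%:~R by rewrite rmorphB rmorphM.
case: z => [[|k]|k].
- by rewrite /= /oharm2_nat big_nat1 big_geq // sub0r.
- rewrite (_ : k.+1%:Z - 1 = k); last by lia.
  by rewrite /= /oharm2_nat [in RHS]big_nat_recr //= castE addrK.
- rewrite (_ : Negz k - 1 = Negz k.+1); last by lia.
  rewrite /= /oharm2_nat [in LHS]big_nat_recr //= castE opprD.
  rewrite -(sqrrN (2 * k.+2%:Z - 1)%:~R) -rmorphN.
  by congr (_ - (_%:~R ^+ 2)^-1); lia.
Qed.

Lemma half_oddE (m i : nat) :
  m%:R + 2^-1 - i%:R = (2 * (m%:Z - i%:Z) + 1)%:~R / 2 :> rat.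
Proof. by rewrite rmorphD rmorphM rmorphB /=; field. Qed.

(** Each term is [2/(2(m-i)+1)], and the sum telescopes by [oharm_sub1], also when [m < n]. *)
Lemma sum_half_odd (m n : nat) :
  \sum_(i < n.+1) (m%:R + 2^-1 - i%:R)^-1
  = 2 * (oharm m.+1%:Z - oharm (m%:Z - n%:Z)).
Proof.
elim: n => [|n IHn].
  rewrite big_ord1 half_oddE (_ : m%:Z - 0%:Z = m.+1%:Z - 1); last by lia.
  rewrite oharm_sub1 invf_div; congr (2 * _); rewrite opprB addrCA subrr addr0.
  by congr (_%:~R^-1); lia.
rewrite big_ord_recr [LHS]/= IHn half_oddE.
rewrite (_ : m%:Z - n.+1%:Z = m%:Z - n%:Z - 1); last by lia.
rewrite oharm_sub1 (_ : 2 * (m%:Z - n%:Z - 1) + 1 = 2 * (m%:Z - n%:Z) - 1); last by lia.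
by rewrite invf_div; ring.
Qed.

Lemma sum_half_odd2 (m n : nat) :
  \sum_(i < n.+1) ((m%:R + 2^-1 - i%:R) ^+ 2)^-1
  = 4 * (oharm2 m.+1%:Z - oharm2 (m%:Z - n%:Z)).
Proof.
elim: n => [|n IHn].
  rewrite big_ord1 half_oddE (_ : m%:Z - 0%:Z = m.+1%:Z - 1); last by lia.
  rewrite oharm2_sub1 expr_div_n invf_div -natrX; congr (_ * _).
  rewrite opprB addrCA subrr addr0.
  by congr ((_%:~R ^+ 2)^-1); lia.
rewrite big_ord_recr [LHS]/= IHn half_oddE.
rewrite (_ : m%:Z - n.+1%:Z = m%:Z - n%:Z - 1); last by lia.
rewrite oharm2_sub1 (_ : 2 * (m%:Z - n%:Z - 1) + 1 = 2 * (m%:Z - n%:Z) - 1); last by lia.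
by rewrite expr_div_n invf_div -natrX; ring.
Qed.

(** With [a = m + 1/2], both sides satisfy [(N+2) u_(N+1) = 4 (N+1-a) u_N]; the constant is read off
    at [N = 0]. *)
Lemma catalan_bincoef (m N : nat) :
  catalan N / oddprod m N%:Z
  = - (2 * (2 * m%:R + 1) * oddprod m 0)^-1
    * 4 ^+ N.+1 * bincoef (m%:R + 2^-1) N.+1.
Proof.
have m0 : 0 <= m%:R :> rat by rewrite ler0n.
have o0 := oddprod_neq0 m 0.
elim: N => [|N IHN].
  rewrite /bincoef big_ord1 /catalan muln0 bin0 -[0%N%:Z]/(0 : int) expr1 /=.
  by field; rewrite o0 /=; apply: lt0r_neq0; lra.
have N2 : N.+2%:R != 0 :> rat by rewrite pnatr_eq0.
apply: (mulfI N2); rewrite mulrA catalanS [RHS]mulrCA bincoefS exprS.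
rewrite [RHS](_ : _ = 4 * (N.+1%:R - (m%:R + 2^-1)) * (catalan N / oddprod m N%:Z)); last first.
  by rewrite IHN; ring.
have shift := oddprod_shift m N%:Z.
have -> : N.+1%:Z = N%:Z + 1 by lia.
have o1 := oddprod_neq0 m N%:Z; have o2 := oddprod_neq0 m (N%:Z + 1).
apply: (mulIf o2); rewrite divfK //; apply: (mulIf o1).
move: shift; rewrite !rmorphD !rmorphM /= rmorphB /= => shift.
transitivity (2 * catalan N * (oddprod m N%:Z * (2 * N%:R + 1))); first by ring.
by rewrite -shift -(natr1 N); field.
Qed.

Theorem proposition7 (m n : nat) :
  \sum_(1 <= k < n.+1)
     (2 ^+ (2 * k - 1)%N * catalan (n - k)%N * harm (k - 1)%N) /
     (k%:R * oddprod m (n%:Z - k%:Z))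
  = (-1) ^+ m * 2 ^+ (2 * n + m)%N / ((2 * m%:R + 1) * (m.+1)`!%:R * n.+1%:R)
      * (harm n / catalan m)
    + ((oharm (m%:Z - n%:Z) - oharm (m.+1)%:Z) ^+ 2
         + oharm2 (m%:Z - n%:Z) - oharm2 (m.+1)%:Z)
      / oddprod m n%:Z * catalan n.
Proof.
set a : rat := m%:R + 2^-1.
have a_notnat i : a - i%:R != 0 by rewrite half_oddE mulf_neq0 ?odd_neq0.
set K := - (2 * (2 * m%:R + 1) * oddprod m 0)^-1.
have lhsE : \sum_(1 <= k < n.+1)
     (2 ^+ (2 * k - 1)%N * catalan (n - k)%N * harm (k - 1)%N) /
     (k%:R * oddprod m (n%:Z - k%:Z))
  = K * 4 ^+ n.+1 / 2
    * (binconv a (fun k => (\sum_(1 <= i < k) i%:R^-1) / k%:R) n.+1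
       - harm n / n.+1%:R).
  (* The term [k = n+1] has [bincoef a 0 = 1] and cancels the subtracted [harm n / (n+1)]; the term
     [k = 0] vanishes because [0^-1 = 0]. *)
  rewrite /binconv big_ord_recr /= subnn [bincoef _ 0]big_ord0 mul1r addrK.
  rewrite big_ord_recl /= invr0 !mulr0 add0r big_add1 /= big_mkord mulr_sumr.
  apply: eq_bigr => -[k /= kn] _; rewrite /bump /= add1n.
  rewrite (subSS k n) (subn1 k.+1) /= (_ : n%:Z - k.+1%:Z = (n - k.+1)%N%:Z); last by lia.
  rewrite invfM.
  transitivity (2 ^+ (2 * k.+1 - 1) * (harm k / k.+1%:R)
                * (catalan (n - k.+1) / oddprod m (n - k.+1)%N%:Z)); first by ring.
  rewrite catalan_bincoef -/K -/a -subSn // subSS.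
  rewrite (_ : 4 = 2 ^+ 2 :> rat); last by ring.
  rewrite -!exprM (_ : (2 * n.+1 = (2 * k.+1 - 1) + (2 * (n - k)).+1)%N); last by lia.
  by rewrite exprD exprS /harm; field; rewrite lt0r_neq0 // ltr_wpDr.
rewrite lhsE binconv_harm // sum_half_odd sum_half_odd2 mulrBr.
have cn := catalan_bincoef m n; rewrite -/K -/a in cn.
have cm := oddprod0_catalan m.
have o0 := oddprod_neq0 m 0.
have cm0 : catalan m != 0.
  by rewrite /catalan mulf_neq0 ?invr_eq0 ?pnatr_eq0 -?lt0n ?bin_gt0 ?leq_pmull.
have f0 : (m.+1)`!%:R != 0 :> rat by rewrite pnatr_eq0 -lt0n fact_gt0.
have m1 : 2 * m%:R + 1 != 0 :> rat by apply: lt0r_neq0; have := ler0n rat m; lra.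
have n1 : n.+1%:R != 0 :> rat by rewrite pnatr_eq0.
(* The missing term gives the summand with [H_n], the full convolution the one with [C_n]. *)
rewrite addrC; congr (_ + _); last first.
  by rewrite -[RHS]mulrA [_^-1 * _]mulrC cn; field.
rewrite [RHS](_ : _ = ((-1) ^+ m * 2 ^+ m) * 2 ^+ (2 * n) * harm n
   / ((2 * m%:R + 1) * n.+1%:R * ((m.+1)`!%:R * catalan m))); last first.
  by rewrite exprD; field; rewrite nat1r cm0 f0 n1 m1.
(* Writing [(m+1)! C_m] through [oddprod m 0] cancels [(-1)^m 2^m] and leaves the factors of [K]. *)
rewrite -cm /K exprM (_ : 2 ^+ 2 = 4 :> rat); last by ring.
rewrite exprS.
have s0 : (-1) ^+ m != 0 :> rat by rewrite signr_eq0.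
have p0 : 2 ^+ m != 0 :> rat by rewrite expf_neq0.
by field; rewrite nat1r s0 p0 o0 n1 m1.
Qed.
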